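(* Let $0\le\gamma<1$ and $0<\delta<2(1-\gamma)$, and let $\{x_k\}$ be the random sequence generated by the MSKM algorithm (defined in the context) with parameters $\delta,\gamma$ from a starting point $x_0\in\mathbb{R}^n$. Define $\bar{x}_k=\frac1k\sum_{l=1}^{k}x_l$. Then for all $k\ge1$ $$\mathbb{E}[f(\bar{x}_k)]\le\frac{(1-\gamma)^2\,d(x_0,P)^2+2\delta\gamma f(x_0)}{2\delta k\,(2-2\gamma-\delta)} .$$
   Context: Setting: $A\in\mathbb{R}^{m\times n}$ has rows $a_1^T,\dots,a_m^T$ with $\|a_i\|=1$ for all $i$, $b\in\mathbb{R}^m$, and $P=\{x\in\mathbb{R}^n: Ax\le b\}$ is nonempty. $\|\cdot\|$ is the Euclidean norm, $d(x,P)=\inf_{z\in P}\|x-z\|$, $u^+=\max\{u,0\}$. Fix a sample size $\beta\in\{1,\dots,m\}$. MSKM algorithm (Momentum Sampling Kaczmarz Motzkin): given $x_0\in\mathbb{R}^n$ (deterministic), set $x_1=x_0$; for $k\ge1$, choose a subset $\tau_k\subseteq\{1,\dots,m\}$ of size $\beta$ uniformly at random (independently of the past), let $i^*\in\arg\max_{i\in\tau_k}(a_i^Tx_k-b_i)^+$ (ties broken by any rule), and set $$x_{k+1}=x_k-\delta\,(a_{i^*}^Tx_k-b_{i^*})^+a_{i^*}+\gamma(x_k-x_{k-1}).$$ The function $f:\mathbb{R}^n\to\mathbb{R}$ is $f(x)=\frac12\,\mathbb{E}_\tau\big[\big(\max_{i\in\tau}(a_i^Tx-b_i)^+\big)^2\big]$,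 where $\tau$ is a uniformly random $\beta$-element subset of $\{1,\dots,m\}$. *)

(* Defs.v *)
From HB Require Import structures.
From mathcomp Require Import all_boot all_order all_algebra.
From mathcomp Require Import all_classical all_reals all_analysis.

Set Implicit Arguments.
Unset Strict Implicit.
Unset Printing Implicit Defensive.

Import Order.TTheory GRing.Theory Num.Theory.

Local Open Scope classical_set_scope.
Local Open Scope ring_scope.

(* The library norm `|x| on matrices is the sup norm, hence this definition. *)
Definition eucl_norm (R : realType) (n : nat) (x : 'cV[R]_n) : R :=
  Num.sqrt (\sum_(i < n) x i ord0 ^+ 2).

Definition eucl_dist (R : realType) (n : nat) (x : 'cV[R]_n)
    (P : set 'cV[R]_n) : R :=
  inf [set eucl_norm (x - z) | z in P].

Definition polyhedron (R : realType) (m n : nat) (A : 'M[R]_(m, n))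
    (b : 'cV[R]_m) : set 'cV[R]_n :=
  [set x | forall i : 'I_m, (A *m x) i ord0 <= b i ord0].

Definition arow (R : realType) (m n : nat) (A : 'M[R]_(m, n)) (i : 'I_m) :
    'cV[R]_n := (row i A)^T.

Definition posres (R : realType) (m n : nat) (A : 'M[R]_(m, n))
    (b : 'cV[R]_m) (i : 'I_m) (x : 'cV[R]_n) : R :=
  Num.max ((A *m x) i ord0 - b i ord0) 0.

(* Since posres is nonnegative, the default value 0 does not affect the
   maximum over a nonempty S.  The uniform expectation over the sets of size
   beta is written as an average over the 'C(m, beta) of them. *)
Definition mskm_f (R : realType) (m n : nat) (A : 'M[R]_(m, n))
    (b : 'cV[R]_m) (beta : nat) (x : 'cV[R]_n) : R :=
  2^-1 * ((\sum_(S : {set 'I_m} | #|S| == beta)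
             (\big[Num.max/0]_(i in S) posres A b i x) ^+ 2)
          / 'C(m, beta)%:R).

(* The sigma-algebra generated by all the choices (sampled sets and selected
   indices) made at the iterations 1, ..., k - 1. *)
Definition mskm_past (T : Type) (m : nat) (tau : nat -> T -> {set 'I_m})
    (istar : nat -> T -> 'I_m) (k : nat) : set (set T) :=
  <<s [set B : set T | exists2 j : nat, (1 <= j < k)%N &
         (exists S : {set 'I_m}, B = [set w | tau j w = S]) \/
         (exists i : 'I_m, B = [set w | istar j w = i])] >>.

(* Ties in the argmax may be broken in any way, possibly at random and
   depending on the history: mskm_argmax only asks istar k to be some
   maximizer. *)
Record is_MSKM (R : realType) (d : measure_display) (T : measurableType d)
    (P : probability T R) (m n : nat) (A : 'M[R]_(m, n)) (b : 'cV[R]_m)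
    (beta : nat) (delta gamma : R) (x0 : 'cV[R]_n)
    (tau : nat -> T -> {set 'I_m}) (istar : nat -> T -> 'I_m)
    (x : nat -> T -> 'cV[R]_n) : Prop := IsMSKM {
  mskm_tau_measurable : forall (k : nat) (S : {set 'I_m}),
    (1 <= k)%N -> measurable [set w | tau k w = S] ;
  mskm_istar_measurable : forall (k : nat) (i : 'I_m),
    (1 <= k)%N -> measurable [set w | istar k w = i] ;
  mskm_tau_card : forall (k : nat) (w : T), (1 <= k)%N -> #|tau k w| = beta ;
  mskm_tau_uniform : forall (k : nat) (S : {set 'I_m}),
    (1 <= k)%N -> #|S| = beta ->
    P [set w | tau k w = S] = (('C(m, beta)%:R : R)^-1)%:E ;
  mskm_tau_indep : forall (k : nat) (S : {set 'I_m}) (B : set T),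
    (1 <= k)%N -> mskm_past tau istar k B ->
    P ([set w | tau k w = S] `&` B) = (P [set w | tau k w = S] * P B)%E ;
  mskm_argmax : forall (k : nat) (w : T), (1 <= k)%N ->
    istar k w \in tau k w /\
    (forall j : 'I_m, j \in tau k w ->
       posres A b j (x k w) <= posres A b (istar k w) (x k w)) ;
  mskm_init0 : forall w : T, x 0%N w = x0 ;
  mskm_init1 : forall w : T, x 1%N w = x0 ;
  mskm_step : forall (k : nat) (w : T), (1 <= k)%N ->
    x k.+1 w = x k w
      - (delta * posres A b (istar k w) (x k w)) *: arow A (istar k w)
      + gamma *: (x k w - x k.-1 w)
}.

Definition cesaro_avg (R : realType) (T : Type) (n : nat)
    (x : nat -> T -> 'cV[R]_n) (k : nat) (w : T) : 'cV[R]_n :=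
  k%:R^-1 *: \sum_(1 <= l < k.+1) x l w.

(* Main.v *)
Require Import Defs.
From HB Require Import structures.
From mathcomp Require Import all_boot all_order all_algebra.
From mathcomp Require Import all_classical all_reals all_analysis.
From mathcomp Require Import ring lra.

(* With y_l = x_l - gamma x_{l-1} the iteration reads y_{l+1} = y_l - delta r a,
   where a is the selected row and r its residual at x_l.  For z in P, expand
   |y_{l+1} - (1 - gamma) z|^2: the cross term is bounded by a.z <= b_i and by
   convexity of the squared residual along x_{l-1}, x_l.  Since x_{l-1} and x_l
   depend only on the selections before step l, the expected squared sampled
   maxima are 2 E f(x_l) and 2 E f(x_{l-1}), so the inequalities telescope; then
   use Jensen for the convex f and take the infimum over z. *)

Set Implicit Arguments.
Unset Strict Implicit.
Unset Printing Implicit Defensive.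

Import Order.TTheory GRing.Theory Num.Theory.

Local Open Scope classical_set_scope.
Local Open Scope ring_scope.

(** * Pathwise inequalities: convexity of the residuals, one momentum step, passage to the
    distance *)

Section Deterministic.
Context {R : realType} {m n : nat}.
Implicit Types (A : 'M[R]_(m, n)) (b : 'cV[R]_m) (u v x y z : 'cV[R]_n).

Definition dotv u v : R := \sum_(i < n) u i ord0 * v i ord0.

Lemma eucl_norm_sqr u : eucl_norm u ^+ 2 = dotv u u.
Proof.
rewrite sqr_sqrtr; last by apply: sumr_ge0 => i _; exact: sqr_ge0.
by apply: eq_bigr => i _; rewrite expr2.
Qed.

Lemma dotv_ge0 u : 0 <= dotv u u.
Proof. by rewrite -eucl_norm_sqr sqr_ge0. Qed.

Lemma dotvBr u v y : dotv u (v - y) = dotv u v - dotv u y.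
Proof. by rewrite -sumrB; apply: eq_bigr => i _; rewrite !mxE mulrBr. Qed.

Lemma dotvZr c u v : dotv u (c *: v) = c * dotv u v.
Proof. by rewrite mulr_sumr; apply: eq_bigr => i _; rewrite mxE mulrCA. Qed.

Lemma dotvZZ c u : dotv (c *: u) (c *: u) = c ^+ 2 * dotv u u.
Proof. by rewrite mulr_sumr; apply: eq_bigr => i _; rewrite !mxE; ring. Qed.

Lemma dotv_sub_scale u v c :
  dotv (u - c *: v) (u - c *: v)
  = dotv u u - 2 * c * dotv v u + c ^+ 2 * dotv v v.
Proof.
rewrite !mulr_sumr -sumrB -big_split; apply: eq_bigr => i _.
by rewrite !mxE /=; ring.
Qed.

Lemma mulmx_dotv A i x : (A *m x) i ord0 = dotv (arow A i) x.
Proof. by rewrite mxE; apply: eq_bigr => j _; rewrite !mxE. Qed.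

Lemma posres_ge0 A b i x : 0 <= posres A b i x.
Proof. by rewrite /posres le_max lexx orbT. Qed.

Definition max_posres A b (S : {set 'I_m}) x : R :=
  \big[Num.max/0]_(i in S) posres A b i x.

Lemma max_posres_ge0 A b S x : 0 <= max_posres A b S x.
Proof. exact: bigmax_ge_id. Qed.

Lemma max_posres_argmax A b (S : {set 'I_m}) x i : i \in S ->
  (forall j, j \in S -> posres A b j x <= posres A b i x) ->
  max_posres A b S x = posres A b i x.
Proof.
move=> iS imax; apply/eqP; rewrite eq_le; apply/andP; split.
  by apply: bigmax_le => //; exact: posres_ge0.
exact: le_bigmax_cond.
Qed.

Lemma mskm_f_ge0 A b beta x : 0 <= mskm_f A b beta x.
Proof.
rewrite mulr_ge0 ?invr_ge0// mulr_ge0 ?invr_ge0//.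
by apply: sumr_ge0 => S _; exact: sqr_ge0.
Qed.

(** The sum of the squared deviations from the mean [mu] is nonnegative. *)
Lemma sqr_mean_le (k : nat) (a : nat -> R) : (0 < k)%N ->
  (k%:R^-1 * \sum_(1 <= l < k.+1) a l) ^+ 2
  <= k%:R^-1 * \sum_(1 <= l < k.+1) a l ^+ 2.
Proof.
move=> k0; set mu := k%:R^-1 * _.
have kR : (k%:R : R) != 0 by rewrite pnatr_eq0 -lt0n.
have muE : \sum_(1 <= l < k.+1) a l = k%:R * mu by rewrite mulVKf.
have : 0 <= \sum_(1 <= l < k.+1) (a l - mu) ^+ 2.
  by apply: sumr_ge0 => l _; exact: sqr_ge0.
have -> : \sum_(1 <= l < k.+1) (a l - mu) ^+ 2 =
    \sum_(1 <= l < k.+1) a l ^+ 2 - 2 * mu * (k%:R * mu) + k%:R * mu ^+ 2.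
  rewrite -muE mulr_sumr -sumrB.
  have -> : k%:R * mu ^+ 2 = \sum_(1 <= l < k.+1) mu ^+ 2.
    by rewrite sumr_const_nat subn1 mulr_natl.
  by rewrite -big_split /=; apply: eq_bigr => l _; ring.
move=> h; rewrite -(ler_pM2l (_ : 0 < k%:R)) ?ltr0n// mulVKf//.
by move: h; rewrite expr2; lra.
Qed.

(** Convexity of the positive part of an affine function: the affine part and 0 are each at most the
    average. *)
Lemma posres_mean_le A b i (k : nat) (x : nat -> 'cV[R]_n) : (0 < k)%N ->
  posres A b i (k%:R^-1 *: \sum_(1 <= l < k.+1) x l)
  <= k%:R^-1 * \sum_(1 <= l < k.+1) posres A b i (x l).
Proof.
move=> k0; have kR : (k%:R : R) != 0 by rewrite pnatr_eq0 -lt0n.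
have kV : (0 : R) <= k%:R^-1 by rewrite invr_ge0.
rewrite {1}/posres ge_max; apply/andP; split; last first.
  by rewrite mulr_ge0// sumr_ge0// => l _; exact: posres_ge0.
have -> : (A *m (k%:R^-1 *: \sum_(1 <= l < k.+1) x l)) i ord0 - b i ord0 =
    k%:R^-1 * \sum_(1 <= l < k.+1) ((A *m x l) i ord0 - b i ord0).
  rewrite -scalemxAr mulmx_sumr mxE summxE sumrB mulrBr.
  by rewrite sumr_const_nat subn1 -[b i ord0 *+ k]mulr_natl mulKf.
rewrite ler_wpM2l// ler_sum// => l _.
by rewrite /posres le_max lexx.
Qed.

(** Jensen, sample by sample: a maximum of convex functions is convex, and squaring is convex and
    monotone on nonnegative values. *)
Lemma mskm_f_mean_le A b beta (k : nat) (x : nat -> 'cV[R]_n) : (0 < k)%N ->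
  mskm_f A b beta (k%:R^-1 *: \sum_(1 <= l < k.+1) x l)
  <= k%:R^-1 * \sum_(1 <= l < k.+1) mskm_f A b beta (x l).
Proof.
move=> k0; have kV : (0 : R) <= k%:R^-1 by rewrite invr_ge0.
rewrite /mskm_f -mulr_sumr [leRHS]mulrCA ler_wpM2l// -mulr_suml mulrA.
rewrite ler_wpM2r ?invr_ge0// exchange_big /= mulr_sumr ler_sum// => S _.
apply: le_trans (sqr_mean_le (fun l => max_posres A b S (x l)) k0).
rewrite ler_sqr ?nnegrE ?max_posres_ge0//; last first.
  by rewrite mulr_ge0// sumr_ge0// => l _; exact: max_posres_ge0.
apply: bigmax_le => [|i iS].
  by rewrite mulr_ge0// sumr_ge0// => l _; exact: max_posres_ge0.
apply: le_trans (posres_mean_le _ _ _ _ k0) _.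
by rewrite ler_wpM2l// ler_sum// => l _; exact: le_bigmax_cond.
Qed.

(* In the variable [x - gamma *: x'] the momentum step is a plain Kaczmarz
   step; the term in [gamma] comes from convexity of the squared residual. *)
Lemma momentum_step_le A b (delta gamma : R) i (S : {set 'I_m}) x x' z :
  0 <= gamma <= 1 -> 0 <= delta -> eucl_norm (arow A i) = 1 ->
  polyhedron A b z -> i \in S ->
  (forall j, j \in S -> posres A b j x <= posres A b i x) ->
  let x'' := (x - (delta * posres A b i x) *: arow A i + gamma *: (x - x'))%R in
  let u := (x - gamma *: x' - (1 - gamma) *: z)%R in
  let u' := (x'' - gamma *: x - (1 - gamma) *: z)%R in
  dotv u' u' <= dotv u u
    - delta * (2 - 2 * gamma - delta) * max_posres A b S x ^+ 2
    - delta * gamma * (max_posres A b S x ^+ 2 - max_posres A b S x' ^+ 2).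
Proof.
move=> /andP[g0 g1] d0 Ai zP iS imax; rewrite (max_posres_argmax iS imax).
set r := posres A b i x; cbv zeta.
set u := x - _ - _; set u' := _ - _ - _.
have -> : u' = u - (delta * r) *: arow A i.
  by rewrite /u' /u; apply/matrixP => p q; rewrite !mxE; ring.
rewrite dotv_sub_scale -(eucl_norm_sqr (arow A i)) Ai expr1n mulr1.
have qM : posres A b i x' ^+ 2 <= max_posres A b S x' ^+ 2.
  rewrite ler_sqr ?nnegrE ?posres_ge0 ?max_posres_ge0//.
  exact: le_bigmax_cond.
have r0 : 0 <= r by exact: posres_ge0.
set M := max_posres _ _ _ _ in qM *.
have := zP i; rewrite mulmx_dotv => zi.
have rE : r = Num.max (dotv (arow A i) x - b i ord0) 0.
  by rewrite /r /posres mulmx_dotv.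
have qE : posres A b i x' = Num.max (dotv (arow A i) x' - b i ord0) 0.
  by rewrite /posres mulmx_dotv.
(* Here x - gamma x' is written as (1 - gamma) x + gamma (x - x'); [h1] bounds the first part of the
   cross term and [h2] the second. *)
have -> : dotv (arow A i) u =
    (1 - gamma) * (dotv (arow A i) x - dotv (arow A i) z)
    + gamma * (dotv (arow A i) x - dotv (arow A i) x').
  by rewrite /u !dotvBr !dotvZr; ring.
(* Only reals remain: [p], [p'], [t] are the products of the row with [x], [x'], [z]; [q] is the
   residual at [x'] and [c] the entry of [b]. *)
move: zi rE qE qM.
move: (dotv _ x) (dotv _ x') (dotv _ z) (posres _ _ _ x') (b i ord0) => p p' t q c.
move=> tc rE qE qM.
(* If r > 0 then r = p - c, and t <= c because [z] is feasible. *)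
have h1 : r ^+ 2 <= r * (p - t).
  rewrite rE; case: (leP (p - c) 0) => h; first by rewrite expr0n mul0r.
  by rewrite expr2 ler_pM2l ?lerD2l ?lerN2.
(* Gradient inequality for the squared residual: p' - c <= q, and 2 r q <= r^2 + q^2. *)
have h2 : r ^+ 2 - q ^+ 2 <= 2 * (r * (p - p')).
  rewrite rE; case: (leP (p - c) 0) => h; first by rewrite expr0n mul0r mulr0 sub0r oppr_le0 sqr_ge0.
  have pq : p' - c <= q by rewrite qE le_max lexx.
  have : (p - c) * (p' - c) <= (p - c) * q by rewrite ler_pM2l.
  by have := sqr_ge0 (p - c - q); rewrite !expr2; lra.
have h3 : delta * (1 - gamma) * r ^+ 2 <= delta * (1 - gamma) * (r * (p - t)).
  by rewrite ler_wpM2l// mulr_ge0// subr_ge0.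
have h4 : delta * gamma * (r ^+ 2 - M ^+ 2)
          <= delta * gamma * (2 * (r * (p - p'))).
  by rewrite ler_wpM2l ?mulr_ge0//; lra.
by lra.
Qed.

(** For K > 0, the square root of K / c^2 is a lower bound of the distances to points of [P], hence
    of their infimum. *)
Lemma le_eucl_dist_sqr (c K : R) x (P : set 'cV[R]_n) : 0 < c -> P !=set0 ->
  (forall z, P z -> K <= c ^+ 2 * eucl_norm (x - z) ^+ 2) ->
  K <= c ^+ 2 * eucl_dist x P ^+ 2.
Proof.
move=> c0 P0 hK; have [K0|/ltW K0] := leP K 0.
  by rewrite (le_trans K0)// -exprMn sqr_ge0.
rewrite -ler_pdivrMl ?exprn_gt0// -[leLHS]sqr_sqrtr; last first.
  by rewrite mulr_ge0// invr_ge0 exprn_ge0// ltW.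
have nn z : 0 <= eucl_norm (x - z) by exact: sqrtr_ge0.
have low : Num.sqrt ((c ^+ 2)^-1 * K) <= eucl_dist x P.
  apply: lb_le_inf; first by case: P0 => z Pz; exists (eucl_norm (x - z)), z.
  move=> _ [z Pz <-]; rewrite -[leRHS]ger0_norm// -sqrtr_sqr ler_wsqrtr//.
  by rewrite ler_pdivrMl ?exprn_gt0//; exact: hK.
by rewrite ler_sqr ?nnegrE ?sqrtr_ge0// (le_trans _ low)// sqrtr_ge0.
Qed.

End Deterministic.

(** * Events and expectations of random variables with finitely many values *)

Lemma sigma_algebra_ffun_fiber (T : Type) (G : set (set T)) (k : nat)
    (F : finType) (U : nat -> T -> F) : sigma_algebra [set: T] G ->
  (forall j v, (j < k)%N -> G [set w | U j w = v]) ->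
  forall h : {ffun 'I_k -> F}, G [set w | [ffun j : 'I_k => U j w] = h].
Proof.
move=> [G0 GC GU] GUj h.
(* The fiber is the complement of a union of complements; empty sets extend the finite family to the
   countable union that [GU] expects. *)
pose B j := if insub j is Some i then
  [set: T] `\` [set w | U j w = h i] else set0.
have -> : [set w | [ffun j : 'I_k => U j w] = h] = [set: T] `\` \bigcup_j B j.
  apply/seteqP; split=> w /=.
    move=> Uh; split=> // -[j _]; rewrite /B.
    by case: insubP => // i _ <- [_]; apply; rewrite /= -Uh ffunE.
  move=> [_ nB]; apply/ffunP => i; rewrite ffunE.
  apply: contrapT => neq; apply: nB; exists (i : nat) => //.
  by rewrite /B valK.
apply: (GC); apply: GU => j; rewrite /B.
by case: insubP => // i ik _; apply: GC; exact: GUj.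
Qed.

Section FiniteRandomVariables.
Context {R : realType} {d : measure_display} {T : measurableType d}.
Variable P : probability T R.

Definition prob_fiber (F : Type) (Y : T -> F) (y : F) : R :=
  fine (P [set w | Y w = y]).

(** The integrand is a finite combination of indicators of the fibers of [Y]. *)
Lemma expectation_comp_fin (F : finType) (Y : T -> F) (g : F -> R) :
  (forall y, measurable [set w | Y w = y]) ->
  ('E_P[fun w => g (Y w)])%E = (\sum_y prob_fiber Y y * g y)%:E.
Proof.
move=> mY; rewrite unlock.
under eq_integral => w _.
  have -> : (g (Y w))%:E =
      (\sum_y (g y)%:E * (\1_[set w' | Y w' = y] w)%:E)%E.
    rewrite (bigD1 (Y w)) //= indicE mem_set// mule1 big1 ?adde0// => y yY.
    by rewrite indicE memNset ?mule0// => /esym/eqP; rewrite (negbTE yY).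
  over.
rewrite integral_sum//; last first.
  by move=> y; apply: integrableZl => //; exact: integrable_indic.
rewrite -sumEFin; apply: eq_bigr => y _.
rewrite integralZl//; last exact: integrable_indic.
by rewrite integral_indic// setIT EFinM /prob_fiber fineK ?fin_num_measure// muleC.
Qed.

(** The law of the pair is the product law, so the finite sum over pairs splits into an outer sum
    over [u] and an inner expectation. *)
Lemma expectation_comp_indep (F1 F2 : finType) (U : T -> F1) (V : T -> F2)
    (g : F1 -> F2 -> R) :
  (forall u, measurable [set w | U w = u]) ->
  (forall v, measurable [set w | V w = v]) ->
  (forall u v, P ([set w | U w = u] `&` [set w | V w = v])
     = (P [set w | U w = u] * P [set w | V w = v])%E) ->
  fine ('E_P[fun w => g (U w) (V w)])%E =
  \sum_u prob_fiber U u * fine ('E_P[fun w => g u (V w)])%E.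
Proof.
move=> mU mV UV; pose W w := (U w, V w).
have WE p : [set w | W w = p] = [set w | U w = p.1] `&` [set w | V w = p.2].
  apply/seteqP; split=> w /=; first by move=> <-.
  by case: p => u v /= [<- <-].
have mW p : measurable [set w | W w = p] by rewrite WE; exact: measurableI.
rewrite (expectation_comp_fin (fun p => g p.1 p.2) mW) /=.
under [in RHS]eq_bigr => u _ do
  rewrite (expectation_comp_fin (g u) mV) /= mulr_sumr.
rewrite pair_bigA /=; apply: eq_bigr => -[u v] _ /=.
by rewrite mulrA /prob_fiber WE UV fineM ?fin_num_measure.
Qed.

Variables (F : finType) (Y : T -> F) (t0 : T).
Hypothesis mY : forall y, measurable [set w | Y w = y].

(* For functions that factor through [Y] this is the expectation; unlike the
   integral it is linear and monotone on all functions. *)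
Definition fin_mean (f : T -> R) : R :=
  \sum_y prob_fiber Y y * f (xget t0 [set w | Y w = y]).

Lemma expectation_fin_mean (f : T -> R) :
  (forall w w', Y w = Y w' -> f w = f w') -> ('E_P[f])%E = (fin_mean f)%:E.
Proof.
move=> fY; rewrite -expectation_comp_fin//; congr ('E_P[_])%E.
apply/funext => w; apply: fY.
(* The fiber of [Y w] contains [w], so [xget] returns a point of it and not the default [t0]. *)
by rewrite (xgetPex t0 (P := [set w' | Y w' = Y w]))//; exists w.
Qed.

Lemma prob_fiber_ge0 y : 0 <= prob_fiber Y y.
Proof. by rewrite fine_ge0. Qed.

Lemma fin_mean_le (f g : T -> R) : (forall w, f w <= g w) ->
  fin_mean f <= fin_mean g.
Proof. by move=> fg; apply: ler_sum => y _; rewrite ler_wpM2l// prob_fiber_ge0. Qed.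

Lemma fin_meanD (f g : T -> R) :
  fin_mean (fun w => f w + g w) = fin_mean f + fin_mean g.
Proof. by rewrite -big_split; apply: eq_bigr => y _; rewrite mulrDr. Qed.

Lemma fin_meanZ c (f : T -> R) : fin_mean (fun w => c * f w) = c * fin_mean f.
Proof. by rewrite mulr_sumr; apply: eq_bigr => y _; rewrite mulrCA. Qed.

Lemma fin_mean_sum (I : Type) (s : seq I) (Q : pred I) (f : I -> T -> R) :
  fin_mean (fun w => \sum_(i <- s | Q i) f i w) =
  \sum_(i <- s | Q i) fin_mean (f i).
Proof.
by rewrite exchange_big; apply: eq_bigr => y _; rewrite mulr_sumr.
Qed.

Lemma fin_mean_cst c : fin_mean (fun=> c) = c.
Proof.
by have := expectation_fin_mean (f := cst c) (fun _ _ _ => erefl);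
   rewrite expectation_cst => -[].
Qed.

End FiniteRandomVariables.

(** * Dependence of the iterates on the random choices *)

Section MSKM.
Context {R : realType} {d : measure_display} {T : measurableType d}.
Context {P : probability T R} {m n : nat} {A : 'M[R]_(m, n)} {b : 'cV[R]_m}.
Context {beta : nat} {delta gamma : R} {x0 : 'cV[R]_n}.
Context {tau : nat -> T -> {set 'I_m}} {istar : nat -> T -> 'I_m}.
Context {x : nat -> T -> 'cV[R]_n}.
Hypothesis hx : is_MSKM P A b beta delta gamma x0 tau istar x.

(** The selection of round l first enters in x_{l+1}, so agreement strictly before [l] is enough. *)
Lemma mskm_iterate_determined l w w' :
  (forall j, (0 < j < l)%N -> istar j w = istar j w') ->
  forall j, (j <= l)%N -> x j w = x j w'.
Proof.
move=> ww'; elim/ltn_ind=> -[|[|j]] IH jl.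
- by rewrite !(mskm_init0 hx).
- by rewrite !(mskm_init1 hx).
- rewrite !(mskm_step hx _ (ltn0Sn j)) /= (IH j.+1)// 1?ltnW// (IH j)//; last first.
    by rewrite (leq_trans _ jl)// leqW.
  by rewrite ww'.
Qed.

(** Rounds are numbered from 1, hence the shift. This variable determines the iterates up to [k.+1]
    and is independent of [tau k.+1]. *)
Definition selections (k : nat) (w : T) : {ffun 'I_k -> 'I_m} :=
  [ffun j : 'I_k => istar j.+1 w].

(** The sampled sets are recorded too, so that sampled maxima also factor through it. *)
Definition history (k : nat) (w : T) : {ffun 'I_k -> {set 'I_m} * 'I_m} :=
  [ffun j : 'I_k => (tau j.+1 w, istar j.+1 w)].

Lemma selections_eq k w w' : selections k w = selections k w' ->
  forall j, (0 < j <= k)%N -> istar j w = istar j w'.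
Proof.
move=> /ffunP ww' [//|j] /= jk.
by have := ww' (Ordinal jk); rewrite !ffunE.
Qed.

Lemma history_eq k w w' : history k w = history k w' ->
  forall j, (0 < j <= k)%N -> tau j w = tau j w' /\ istar j w = istar j w'.
Proof.
move=> /ffunP ww' [//|j] /= jk.
by have := ww' (Ordinal jk); rewrite !ffunE => -[].
Qed.

Lemma past_selections k h :
  mskm_past tau istar k.+1 [set w | selections k w = h].
Proof.
apply: (@sigma_algebra_ffun_fiber _ _ _ _ (fun j => istar j.+1)).
  exact: smallest_sigma_algebra.
move=> j i jk; apply: sub_sigma_algebra; exists j.+1 => //.
by right; exists i.
Qed.

Lemma measurable_selections k h : measurable [set w | selections k w = h].
Proof.
apply: (@sigma_algebra_ffun_fiber _ _ _ _ (fun j => istar j.+1)).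
  exact: sigma_algebra_measurable.
by move=> j i _; exact: (mskm_istar_measurable hx).
Qed.

Lemma measurable_history k h : measurable [set w | history k w = h].
Proof.
apply: (@sigma_algebra_ffun_fiber _ _ _ _ (fun j w => (tau j.+1 w, istar j.+1 w))).
  exact: sigma_algebra_measurable.
move=> j [S i] _.
have -> : [set w | (tau j.+1 w, istar j.+1 w) = (S, i)]
    = [set w | tau j.+1 w = S] `&` [set w | istar j.+1 w = i].
  by apply/seteqP; split=> w /= => [[-> ->]|[-> ->]].
apply: measurableI; first exact: (mskm_tau_measurable hx).
exact: (mskm_istar_measurable hx).
Qed.

Lemma prob_fiber_tau k S : (0 < k)%N ->
  prob_fiber P (tau k) S = if #|S| == beta then 'C(m, beta)%:R^-1 else 0.
Proof.
move=> k0; rewrite /prob_fiber; case: eqP => Sb.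
  by rewrite (mskm_tau_uniform hx).
rewrite (_ : [set w | _] = set0) ?measure0//.
by apply/seteqP; split=> w //= wS; apply: Sb; rewrite -wS (mskm_tau_card hx).
Qed.

Variables (K : nat) (t0 : T).
(** A single horizon [K] makes every mean a sum over the same finite set, so inequalities from
    different rounds can be added. *)
Let Ex := fin_mean P (history K) t0.

(** x_j is a function of the selections before round [l], hence independent of [tau l]; averaging
    over the uniform sample gives 2 f(x_j). Both j = l and j = l - 1 are needed, since the momentum
    inequality compares two iterates on one sample. *)
Lemma fin_mean_sampled_residual l j : (0 < l <= K)%N -> (j <= l)%N ->
  Ex (fun w => max_posres A b (tau l w) (x j w) ^+ 2)
  = 2 * Ex (fun w => mskm_f A b beta (x j w)).
Proof.
move=> /andP[l0 lK] jl.
have xj w w' : selections l.-1 w = selections l.-1 w' -> x j w = x j w'.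
  move=> ww'; apply: (@mskm_iterate_determined l) => // i /andP[i0 il].
  by apply: (selections_eq ww'); rewrite i0 -ltnS prednK.
have xjK w w' : history K w = history K w' -> x j w = x j w'.
  move=> ww'; apply: (@mskm_iterate_determined l) => // i /andP[i0 il].
  have iK : (0 < i <= K)%N by rewrite i0 (leq_trans (ltnW il)).
  by case: (history_eq ww' iK).
have mean f : (forall w w', history K w = history K w' -> f w = f w') ->
    Ex f = fine ('E_P[f])%E.
  by move=> fY; rewrite (expectation_fin_mean P t0 (@measurable_history K) fY).
rewrite /Ex /mskm_f [in RHS]fin_meanZ mulVKf ?pnatr_eq0//.
under [in RHS]eq_fun do rewrite mulrC.
rewrite fin_meanZ fin_mean_sum -/Ex mean; last first.
  move=> w w' ww'; rewrite (xjK w w')//.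
  have lK' : (0 < l <= K)%N by rewrite l0.
  by have [-> _] := history_eq ww' lK'.
(* x_j is recovered from the selections [h] by evaluating it at any outcome that has them. *)
pose g S h := max_posres A b S (x j (xget t0 [set w | selections l.-1 w = h])) ^+ 2.
have gE S w : max_posres A b S (x j w) ^+ 2 = g S (selections l.-1 w).
  rewrite /g; congr (max_posres A b S _ ^+ 2); apply: xj.
  by rewrite (xgetPex t0 (P := [set w' | selections l.-1 w' = selections l.-1 w]))//;
    exists w.
under eq_fun do rewrite gE.
rewrite (expectation_comp_indep g).
- rewrite mulr_sumr [RHS]big_mkcond; apply: eq_bigr => S _.
  rewrite prob_fiber_tau//; case: ifP => _; last by rewrite mul0r.
  congr (_ * _); rewrite mean; last by move=> w w' ww'; rewrite (xjK w w').
  by congr (fine ('E_P[_])%E); apply/funext => w; rewrite -gE.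
- by move=> S; exact: (mskm_tau_measurable hx).
- exact: measurable_selections.
- move=> S h; apply: (mskm_tau_indep hx) => //.
  by have := past_selections h; rewrite prednK.
Qed.

(** * Telescoping the expected one-step inequality *)

Hypotheses (hgamma : 0 <= gamma < 1) (hdelta : 0 < delta).
Hypothesis hA : forall i : 'I_m, eucl_norm (arow A i) = 1.

Let mean_f l := Ex (fun w => mskm_f A b beta (x l w)).

(** The potential [D l + 2 * delta * gamma * mean_f l] drops in each round by at least [2 * delta *
    (2 - 2 * gamma - delta) * mean_f l.+1]. *)
Lemma mean_f_sum_le z k : polyhedron A b z -> (k <= K)%N ->
  2 * delta * (2 - 2 * gamma - delta) * \sum_(1 <= l < k.+1) mean_f l
  <= (1 - gamma) ^+ 2 * eucl_norm (x0 - z) ^+ 2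
     + 2 * delta * gamma * mskm_f A b beta x0.
Proof.
move=> zP; case/andP: hgamma => g0 g1.
pose u l w := x l.+1 w - gamma *: x l w - (1 - gamma) *: z.
pose D l := Ex (fun w => dotv (u l w) (u l w)).
have D0 l : 0 <= D l.
  rewrite -(fin_mean_cst P t0 (@measurable_history K) 0).
  by apply: fin_mean_le => w; exact: dotv_ge0.
have F0 l : 0 <= mean_f l.
  rewrite -(fin_mean_cst P t0 (@measurable_history K) 0).
  by apply: fin_mean_le => w; exact: mskm_f_ge0.
(* Since x_1 = x_0, the initial vector [u 0] is (1 - gamma) (x_0 - z). *)
have D0E : D 0%N = (1 - gamma) ^+ 2 * eucl_norm (x0 - z) ^+ 2.
  rewrite eucl_norm_sqr -dotvZZ -[RHS](fin_mean_cst P t0 (@measurable_history K)).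
  apply: (congr1 Ex); apply/funext => w; rewrite /u (mskm_init0 hx) (mskm_init1 hx).
  by rewrite scalerBr [(1 - gamma) *: x0]scalerBl scale1r.
have F0E : mean_f 0 = mskm_f A b beta x0.
  rewrite -[RHS](fin_mean_cst P t0 (@measurable_history K)).
  by apply: (congr1 Ex); apply/funext => w; rewrite (mskm_init0 hx).
have step l : (l < K)%N -> D l.+1 + 2 * delta * (2 - 2 * gamma - delta) * mean_f l.+1
    + 2 * delta * gamma * mean_f l.+1 <= D l + 2 * delta * gamma * mean_f l.
  move=> lK; pose M j w := max_posres A b (tau l.+1 w) (x j w) ^+ 2.
  have MS : Ex (M l.+1) = 2 * mean_f l.+1 by exact: fin_mean_sampled_residual.
  have Ml : Ex (M l) = 2 * mean_f l by exact: fin_mean_sampled_residual.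
  have : Ex (fun w => dotv (u l.+1 w) (u l.+1 w)
        + (delta * (2 - 2 * gamma - delta) * M l.+1 w + delta * gamma * M l.+1 w))
      <= Ex (fun w => dotv (u l w) (u l w) + delta * gamma * M l w).
    apply: fin_mean_le => w.
    have [iS imax] := mskm_argmax hx w (ltn0Sn l).
    have gg : 0 <= gamma <= 1 by rewrite g0 ltW.
    have := momentum_step_le (x l w) gg (ltW hdelta) (hA (istar l.+1 w)) zP iS imax.
    rewrite /= /u (mskm_step hx _ (ltn0Sn l)) /= /M.
    by lra.
  rewrite /Ex !fin_meanD !fin_meanZ -/Ex MS Ml -/(D l) -/(D l.+1).
  by lra.
(* The induction needs the final potential on the left; both of its terms are nonnegative and are
   dropped afterwards. *)
suff : (k <= K)%N -> D k
    + 2 * delta * (2 - 2 * gamma - delta) * (\sum_(1 <= l < k.+1) mean_f l)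
    + 2 * delta * gamma * mean_f k
    <= (1 - gamma) ^+ 2 * eucl_norm (x0 - z) ^+ 2
       + 2 * delta * gamma * mskm_f A b beta x0.
  move=> /[apply]; apply: le_trans.
  have : 0 <= 2 * delta * gamma * mean_f k.
    by rewrite mulr_ge0// mulr_ge0// mulr_ge0// ltW.
  by have := D0 k; lra.
elim: k => [_|k IH kK]; first by rewrite big_nil mulr0 addr0 D0E F0E.
rewrite big_nat_recr//= mulrDr.
have := step k kK; have := IH (ltnW kK).
by lra.
Qed.

End MSKM.

(** * The bound for the averaged iterate *)

Theorem theorem4p9 (R : realType) (m n : nat) (A : 'M[R]_(m, n))
    (b : 'cV[R]_m) (beta : nat) (delta gamma : R) (x0 : 'cV[R]_n)
    (d : measure_display) (T : measurableType d) (P : probability T R)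
    (tau : nat -> T -> {set 'I_m}) (istar : nat -> T -> 'I_m)
    (x : nat -> T -> 'cV[R]_n)
    (hA : forall i : 'I_m, eucl_norm (arow A i) = 1)
    (hP : polyhedron A b !=set0)
    (hbeta : (1 <= beta <= m)%N)
    (hgamma : 0 <= gamma < 1)
    (hdelta : 0 < delta < 2 * (1 - gamma))
    (hx : is_MSKM P A b beta delta gamma x0 tau istar x) :
  forall k : nat, (1 <= k)%N ->
    ('E_P[fun w => mskm_f A b beta (cesaro_avg x k w)] <=
     (((1 - gamma) ^+ 2 * eucl_dist x0 (polyhedron A b) ^+ 2
       + 2 * delta * gamma * mskm_f A b beta x0)
      / (2 * delta * k%:R * (2 - 2 * gamma - delta)))%:E)%E.
Proof.
move=> k k1.
(* [fin_mean] needs a default outcome; an empty [T] would have total mass 0 instead of 1. *)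
have [t0] : exists t0 : T, True.
  apply: contrapT => noT.
  have T0 : [set: T] = set0 by apply/seteqP; split=> t // _; apply: noT; exists t.
  have := probability_setT P; rewrite T0 measure0 => /eqP.
  by rewrite eqe eq_sym oner_eq0.
move=> _; case/andP: hdelta => d0 d2; case/andP: (hgamma) => g0 g1.
rewrite (expectation_fin_mean P t0 (measurable_history hx (k := k))); last first.
  move=> w w' ww'; congr (mskm_f A b beta (_ *: _)).
  apply: eq_big_nat => l /andP[l1 lk].
  apply: (@mskm_iterate_determined _ _ _ _ _ _ _ _ _ _ _ _ _ _ _ hx k) => // j /andP[j0 jk].
  have jk' : (0 < j <= k)%N by rewrite j0 ltnW.
  by case: (history_eq ww' jk').
rewrite lee_fin.
have k0 : (0 : R) < k%:R by rewrite ltr0n.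
have e0 : 0 < 2 - 2 * gamma - delta by lra.
have den : 0 < 2 * delta * k%:R * (2 - 2 * gamma - delta).
  by rewrite !mulr_gt0.
rewrite ler_pdivlMr//.
pose mean_f l := fin_mean P (@history _ _ _ tau istar k) t0 (fun w => mskm_f A b beta (x l w)).
have avg : fin_mean P (@history _ _ _ tau istar k) t0
      (fun w => mskm_f A b beta (cesaro_avg x k w))
    <= k%:R^-1 * \sum_(1 <= l < k.+1) mean_f l.
  rewrite -fin_mean_sum -fin_meanZ; apply: fin_mean_le => w.
  exact: (mskm_f_mean_le _ _ _ (fun l => x l w)).
(* Multiplying Jensen's bound by the denominator cancels the factor 1/k. *)
apply: (@le_trans _ _
    (2 * delta * (2 - 2 * gamma - delta) * \sum_(1 <= l < k.+1) mean_f l)).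
  move: avg; rewrite -(ler_pM2r den) => /le_trans; apply.
  set s := \sum_(_ <= _ < _) _.
  by rewrite le_eqVlt; apply/orP; left; apply/eqP; field; rewrite gt_eqF.
(* With the f(x_0) term moved to the left, only the distance term depends on [z], and the infimum is
   taken with c = 1 - gamma > 0. *)
rewrite -lerBlDr; apply: le_eucl_dist_sqr => //; first by rewrite subr_gt0.
by move=> z zP; rewrite lerBlDr; exact: mean_f_sum_le.
Qed.
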